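(* Let $\mathcal{G}_1$ and $\mathcal{G}_2$ be two ADMGs on the same vertex set. Then $\mathcal{G}_1$ and $\mathcal{G}_2$ are Markov equivalent if and only if $\mathcal{S}(\mathcal{G}_1)=\mathcal{S}(\mathcal{G}_2)$.
   Context: An acyclic directed mixed graph (ADMG) $\mathcal{G}$ on a finite vertex set $\mathcal{V}$ has directed ($a\to b$) and bidirected ($a\leftrightarrow b$) edges and no directed cycle. $\mathrm{pa}_{\mathcal{G}}(v)=\{w:w\to v\}$, $\mathrm{an}_{\mathcal{G}}(v)$ ($\mathrm{de}_{\mathcal{G}}(v)$) is $v$ together with vertices having a directed path to (from) $v$, $\mathrm{dis}_{\mathcal{G}}(v)$ is $v$ together with vertices joined to $v$ by a path of bidirected edges; for sets take unions. For $W\subseteq\mathcal{V}$, $\mathcal{G}_W$ is the induced subgraph and $\mathrm{dis}_W(\cdot)$ the district in $\mathcal{G}_W$. A path is a sequence of distinct vertices, consecutive ones joined by an edge; a non-endpoint $w$ is a collider if both path edges at $w$ have an arrowhead at $w$ (each is $\to w$ or $\leftrightarrow w$), else a noncollider. For $a,b\notin C$, a path between $a,b$ is m-connecting given $C$ if all noncolliders are outside $C$ and all colliders are in $\mathrm{an}_{\mathcal{G}}(C)$; for disjoint $A,B,C$ with $A,B$ nonempty, $A,B$ are m-separated by $C$ if no such path joins any $a\in A$, $b\in B$. Two graphs on the same vertex set are Markov equivalent if exactly the same m-separations hold in both. $\mathrm{barren}_{\mathcal{G}}(W)=\{w\in W:\mathrm{de}_{\mathcal{G}}(w)\cap W=\{w\}\}$;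 a head is $H\subseteq\mathcal{V}$ with $\mathrm{barren}_{\mathcal{G}}(H)=H$ and $H$ contained in one district of $\mathcal{G}_{\mathrm{an}_{\mathcal{G}}(H)}$; $\mathrm{tail}(H)=(\mathrm{dis}_{\mathrm{an}_{\mathcal{G}}(H)}(H)\setminus H)\cup\mathrm{pa}_{\mathcal{G}}(\mathrm{dis}_{\mathrm{an}_{\mathcal{G}}(H)}(H))$; $\mathcal{S}(\mathcal{G})=\{H\cup A:H\text{ a head},\ A\subseteq\mathrm{tail}(H)\}$. *)

(* Defs.v *)
From mathcomp Require Import all_boot.

Set Implicit Arguments.
Unset Strict Implicit.
Unset Printing Implicit Defensive.

(* [dir x y] is x -> y and [bid x y] is x <-> y; both may hold for the same
   pair of vertices. *)
Record admg (T : finType) : Type := Admg {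
  dir : rel T;
  bid : rel T;
  bid_sym : symmetric bid;
  bid_irr : irreflexive bid;
  dir_acyclic : forall c : seq T, cycle dir c -> c = [::]
}.

Section Admg.
Variables (T : finType) (G : admg T).
Implicit Types (W B H C : {set T}) (a b v : T).

Definition pa W := [set u | [exists w in W, dir G u w]].
Definition an W := [set u | [exists w in W, connect (dir G) u w]].
Definition de W := [set u | [exists w in W, connect (dir G) w u]].

Definition bid_in W : rel T := [rel x y | [&& x \in W, y \in W & bid G x y]].

(* Districts in the induced subgraph on W; vertices outside W have none. *)
Definition dis_in W B :=
  [set u in W | [exists w in B :&: W, connect (bid_in W) w u]].

Definition barren W := [set w in W | de [set w] :&: W == [set w]].

(* The empty set is not a head: an set0 is empty, so it has no district. *)
Definition is_head H :=
  (barren H == H) &&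
  [exists v in an H, H \subset dis_in (an H) [set v]].

Definition tail H :=
  (dis_in (an H) H :\: H) :|: pa (dis_in (an H) H).

Definition param_sets : {set {set T}} :=
  [set H :|: A | H in [set K : {set T} | is_head K], A in powerset (tail H)].

End Admg.

(* An edge as traversed by a path from left to right: ->, <- or <->. *)
Inductive mark := Fwd | Bwd | Bi.

Definition head_at_target (m : mark) := if m is Bwd then false else true.
Definition head_at_source (m : mark) := if m is Fwd then false else true.

Section Separation.
Variables (T : finType) (G : admg T).
Implicit Types (A B C : {set T}) (a b : T).

Definition has_edge a (m : mark) b :=
  match m with
  | Fwd => dir G a b
  | Bwd => dir G b a
  | Bi => bid G a b
  end.

(* A path is its first vertex together with its successive (edge, vertex)
   steps. Edges are recorded because a -> b and a <-> b may coexist, and the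
   choice decides which vertices are colliders. *)
Fixpoint is_walk a (p : seq (mark * T)) :=
  if p is (m, b) :: p' then has_edge a m b && is_walk b p' else true.

Definition is_path a b (p : seq (mark * T)) :=
  [&& is_walk a p, uniq (a :: unzip2 p) & last a (unzip2 p) == b].

(* The last step leads to an endpoint, so only the earlier ones are tested. *)
Fixpoint interior_open C (p : seq (mark * T)) :=
  if p is (m, w) :: p' then
    if p' is (m', _) :: _ then
      (if head_at_target m && head_at_source m'
       then w \in an G C else w \notin C) && interior_open C p'
    else true
  else true.

Definition m_connecting a b C (p : seq (mark * T)) :=
  [&& a \notin C, b \notin C, is_path a b p & interior_open C p].

Definition m_separated A B C : Prop :=
  forall a b p, a \in A -> b \in B -> ~~ m_connecting a b C p.

End Separation.

Definition markov_equivalent (T : finType) (G1 G2 : admg T) : Prop :=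
  forall A B C : {set T},
    A != set0 -> B != set0 ->
    [disjoint A & B] -> [disjoint A & C] -> [disjoint B & C] ->
    (m_separated G1 A B C <-> m_separated G2 A B C).

(* Main.v *)
(* The parametrizing sets are characterised by connection alone: W is one iff it
   is nonempty and any two of its vertices are joined by a walk all of whose
   interior vertices are colliders in an(W). Equivalently, distinct x, y in W are
   m-connected given every C with C :|: {x, y} containing W, so Markov
   equivalence determines the family S.

   Conversely let both graphs have the same S. Call W robust in A if its
   pairs are G2-connected given every C within A as above. Every robust set in a
   G1-ancestral A is in S, by removing one vertex z of V at a time, childless in
   G1 among the vertices that are left: by G1 the members of S containing z are
   closed under union there, and this lets a G2-connecting walk avoid using z as a
   noncollider. Now let a G2-walk connect x and y given C, and take
   A = an_G1(C, x, y). Cut it at its noncolliders in A; the ends and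
   colliders of each piece form a robust set, hence one in S, so consecutive cut
   points are G1-linked through colliders in A. Concatenation gives a G1-connection. *)

Require Import Defs.
From mathcomp Require Import all_boot.
From Stdlib Require Import Classical_Prop.

Set Implicit Arguments.
Unset Strict Implicit.
Unset Printing Implicit Defensive.

(** * Ancestors and walks with marked ends *)

Section Walks.
Variables (T : finType) (G : admg T).
Implicit Types (A B C P Q W : {set T}) (x y z u v : T) (s t : bool).

Lemma mem_an B v : (v \in an G B) = [exists w in B, connect (dir G) v w].
Proof. by rewrite inE. Qed.

Lemma anP B v : reflect (exists2 w, w \in B & connect (dir G) v w) (v \in an G B).
Proof. by rewrite mem_an; apply: exists_inP. Qed.

Lemma sub_an B : B \subset an G B.
Proof. by apply/subsetP => v Bv; apply/anP; exists v. Qed.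

Lemma connect_an B u v : connect (dir G) u v -> v \in an G B -> u \in an G B.
Proof.
by move=> uv /anP[w Bw vw]; apply/anP; exists w => //; apply: connect_trans vw.
Qed.

Lemma dir_an B u v : dir G u v -> v \in an G B -> u \in an G B.
Proof. by move=> uv; apply/connect_an/connect1. Qed.

Lemma an_sub A B : A \subset an G B -> an G A \subset an G B.
Proof.
move=> sAB; apply/subsetP => u /anP[v Av uv].
by apply: connect_an uv _; apply: (subsetP sAB).
Qed.

Lemma anS A B : A \subset B -> an G A \subset an G B.
Proof. by move=> sAB; apply/an_sub/(subset_trans sAB)/sub_an. Qed.

Lemma dir_connect_neq u v : dir G u v -> ~~ connect (dir G) v u.
Proof.
move=> uv; apply/negP => /connectP[p vp eu].
suff /dir_acyclic : cycle (dir G) (v :: p) by [].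
by rewrite /= rcons_path vp -eu.
Qed.

Lemma dir_irr u : dir G u u = false.
Proof. by apply/negP => uu; move: (dir_connect_neq uu); rewrite connect0. Qed.

(* An edge between [x] and [y], where [s] and [t] tell whether it has an
   arrowhead at [x] and at [y]. *)
Definition edge x s y t :=
  match s, t with
  | false, true => dir G x y
  | true, false => dir G y x
  | true, true => bid G x y
  | false, false => false
  end.

Lemma edgeC x s y t : edge x s y t = edge y t x s.
Proof. by case: s t => -[] //=; apply: bid_sym. Qed.

Lemma edge_irr x s t : edge x s x t = false.
Proof. by case: s t => -[] //=; rewrite ?dir_irr ?bid_irr. Qed.

Lemma has_edgeE x m y :
  has_edge G x m y = edge x (head_at_source m) y (head_at_target m).
Proof. by case: m. Qed.

Lemma edge_mark x s y t : edge x s y t ->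
  exists m, [/\ has_edge G x m y, head_at_source m = s & head_at_target m = t].
Proof. by case: s t => -[] //= e; [exists Bi | exists Bwd | exists Fwd]. Qed.

(* [walk P Q x s y t]: a walk with at least one edge, with arrowheads at its
   ends according to [s] and [t], whose colliders lie in [P] and whose
   noncolliders lie in [Q]. *)
Inductive walk P Q x s : T -> bool -> Prop :=
| walk_edge y t : edge x s y t -> walk P Q x s y t
| walk_rcons y t s' z t' : walk P Q x s y t -> edge y s' z t' ->
    y \in (if t && s' then P else Q) -> walk P Q x s z t'.

Lemma walk_dir P Q x y : dir G x y -> walk P Q x false y true.
Proof. exact: (@walk_edge P Q x false y true). Qed.

Lemma walk_cat P Q x s y t s' z t' :
  walk P Q x s y t -> walk P Q y s' z t' ->
  y \in (if t && s' then P else Q) -> walk P Q x s z t'.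
Proof.
move=> xy; elim=> [w r yw|w r s1 v r1 _ IH wv ok] okx.
  exact: walk_rcons xy yw okx.
exact: walk_rcons (IH okx) wv ok.
Qed.

Lemma walk_rev P Q x s y t : walk P Q x s y t -> walk P Q y t x s.
Proof.
elim=> [w r xw|w r s1 v r1 _ IH wv ok]; first by apply: walk_edge; rewrite edgeC.
apply: (walk_cat (y := w) (t := s1) _ IH); last by rewrite andbC.
by apply: walk_edge; rewrite edgeC.
Qed.

Lemma walk_sub P Q P' Q' x s y t : P \subset P' -> Q \subset Q' ->
  walk P Q x s y t -> walk P' Q' x s y t.
Proof.
move=> sP sQ; elim=> [w r xw|w r s1 v r1 _ IH wv ok]; first exact: walk_edge.
apply: walk_rcons IH wv _.
by move: ok; case: ifP => _; apply: subsetP.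
Qed.

(** All vertices of a directed path from [v] are descendants of [v], so none of them is in [C]; the
    path has no collider. *)
Lemma walk_connect P C v x : connect (dir G) v x -> v != x -> v \notin an G C ->
  walk P (~: C) v false x true.
Proof.
case/connectP => p; elim: p v => [|b p IH] v /=; first by move=> _ ->; rewrite eqxx.
case/andP => vb bp ex nvx nvC.
have nbC: b \notin an G C by apply: contra nvC; apply: dir_an.
have [ebx|nbx] := eqVneq b x; first by apply: walk_edge; rewrite -ebx.
apply: walk_cat (walk_dir _ _ vb) (IH b bp ex nbx nbC) _.
by rewrite inE; apply: contra nbC; apply: (subsetP (sub_an C)).
Qed.

Lemma walk_into P C v : v \in an G C -> v \notin C ->
  exists2 c, c \in C & walk P (~: C) v false c true.
Proof.
case/anP => w Cw /connectP[p]; elim: p v => [|b p IH] v /=.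
  by move=> _ <-; rewrite Cw.
case/andP => vb bp ew nvC.
have [bC|nbC] := boolP (b \in C); first by exists b => //; apply: walk_edge.
have [c Cc bc] := IH b bp ew nbC; exists c => //.
by apply: walk_cat (walk_dir _ _ vb) bc _; rewrite inE.
Qed.

(** At a collider [w] outside [C], go down a directed path to the first vertex of [C] and come back.
    Then [w] is passed twice, each time as a noncollider, and the turning point is a collider in
    [C]. *)
Lemma walk_detour C x s y t :
  walk (an G C) (~: C) x s y t -> walk C (~: C) x s y t.
Proof.
elim=> [w r xw|w r s1 v r1 _ IH wv ok]; first exact: walk_edge.
have [wC|nwC] := boolP (w \in C).
  by apply: walk_rcons IH wv _; case: ifP ok => // _; rewrite inE wC.
case: ifP ok => [/andP[r_ s1_]|rs] ok; last by apply: walk_rcons IH wv _; rewrite rs.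
have [c Cc wc] := walk_into C ok nwC.
have ww: walk C (~: C) w false w false by apply: walk_cat wc (walk_rev wc) _.
have xw: walk C (~: C) x s w false by apply: walk_cat IH ww _; rewrite andbF inE.
by apply: walk_rcons xw wv _; rewrite inE.
Qed.

(* A collider that is an ancestor of the start [x] but not of [B] is bypassed
   by the directed path from it to [x]. *)
Lemma walk_shortcut B C x s y t : C \subset B ->
  walk (an G (x |: B)) (~: C) x s y t ->
  exists s', walk (an G B) (~: C) x s' y t.
Proof.
move=> sCB; elim=> [w r xw|w r s1 v r1 _ [s' IH] wv ok].
  by exists s; apply: walk_edge.
have [wB|nwB] := boolP (w \in an G B).
  exists s'; apply: walk_rcons IH wv _.
  by case: ifP ok.
case: ifP ok => rs ok; last by exists s'; apply: walk_rcons IH wv _; rewrite rs.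
have wx: connect (dir G) w x.
  case/anP: ok => u /setU1P[-> //|Bu] wu.
  by case/anP: nwB; exists u.
have [ewx|nwx] := eqVneq w x; first by exists s1; rewrite -ewx; apply: walk_edge.
have nwC: w \notin an G C by apply: contra nwB; apply/subsetP/anS.
exists true; apply: walk_rcons (walk_rev (walk_connect _ wx nwx nwC)) wv _.
by rewrite inE; apply: contra nwC; apply/subsetP/sub_an.
Qed.

(** Walks may repeat vertices, which makes them easy to concatenate; [connP] relates them to
    m-connecting paths. *)
Definition conn x y C := exists s t, walk (an G C) (~: C) x s y t.

(** Colliders that are ancestors of an end only are bypassed, first at [x] and then, on the reversed
    walk, at [y]. *)
Lemma walk_conn x y C s t :
  walk (an G (x |: (y |: C))) (~: C) x s y t -> conn x y C.
Proof.
move=> /(walk_shortcut (subsetUr _ _))[s' /walk_rev].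
case/(walk_shortcut (subxx _)) => t' /walk_rev xy.
by exists s', t'.
Qed.

(* From a noncollider one can leave along a tail, and go on until a collider or
   an endpoint is met. *)
Lemma walk_an B P Q x s y t : P \subset an G B -> x \in an G B -> y \in an G B ->
  walk P Q x s y t -> walk P (Q :&: an G B) x s y t.
Proof.
move=> sPB xB yB xy.
(* For the induction, [y] is assumed to be in [an G B] only if the walk arrives with an arrowhead;
   if it arrives with a tail, this is proved. *)
suff H : (t -> y \in an G B) ->
  walk P (Q :&: an G B) x s y t /\ (~~ t -> y \in an G B) by case: H.
elim: xy {yB} => [w r xw|w r s1 v r1 _ IH wv ok] Hv.
  split; first exact: walk_edge.
  by case: s r xw {Hv} => -[] //= wx _; apply: dir_an wx _.
have wB: w \in an G B.
  case: s1 r1 wv Hv ok => [] r1 wv Hv; last first.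
    move=> _; case: r1 wv Hv => //= wv Hv; exact: dir_an wv (Hv _).
  rewrite andbT; case: r IH => [_ /(subsetP sPB) //|IH _].
  by case: IH => // _; apply.
have [//|xw _] := IH.
split; last by case: s1 r1 wv {Hv ok} => -[] //= wx _; apply: dir_an wx _.
by apply: walk_rcons xw wv _; case: ifP ok => // _; rewrite inE wB => ->.
Qed.

(** Leaving [x] along a tail, the walk is directed up to its first collider, which exists because
    the walk does not end with an arrowhead. That collider is in [an G C]. *)
Lemma tails_an C x y : walk (an G C) (~: C) x false y false -> x \in an G C.
Proof.
move=> xy.
suff H s t : walk (an G C) (~: C) x s y t -> ~~ s ->
   (t /\ connect (dir G) x y) \/ x \in an G C.
  by case: (H _ _ xy isT) => // -[].
elim=> {y xy} [w r xw|w r s1 v r1 _ IH wv ok] ns.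
  by left; case: s r xw ns => -[] //= xw _; split => //; apply: connect1.
case: (IH ns) => [[r_ xw]|]; last by right.
rewrite r_ /= in ok.
case: s1 wv ok => wv ok; first by right; apply: connect_an ok.
left; case: r1 wv => //= wv; split => //.
exact: connect_trans xw (connect1 wv).
Qed.

(** * Walks as lists of steps, and m-connecting paths *)

Lemma interior_open_cons C m w m' v p :
  interior_open G C [:: (m, w), (m', v) & p] =
  (w \in (if head_at_target m && head_at_source m' then an G C else ~: C))
  && interior_open G C ((m', v) :: p).
Proof. by rewrite /=; case: ifP; rewrite ?inE. Qed.

Lemma interior_open_cat C p m w m' v q :
  interior_open G C (rcons p (m, w) ++ (m', v) :: q) =
  [&& interior_open G C (rcons p (m, w)),
      w \in (if head_at_target m && head_at_source m' then an G C else ~: C)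
    & interior_open G C ((m', v) :: q)].
Proof.
elim: p => [|[m1 w1] p IH]; first exact: interior_open_cons.
case: p IH => [|[m2 w2] p] IH.
  by rewrite !rcons_cons !cat_cons !interior_open_cons andbT.
by rewrite !rcons_cons !cat_cons !interior_open_cons -!rcons_cons -cat_cons IH andbA.
Qed.

Lemma is_walk_rcons x p m w :
  is_walk G x (rcons p (m, w)) = is_walk G x p && has_edge G (last x (unzip2 p)) m w.
Proof. by elim: p x => [|[m1 w1] p IH] x //=; rewrite ?andbT // IH andbA. Qed.

Lemma list_walk C x m w p : is_walk G x ((m, w) :: p) ->
  interior_open G C ((m, w) :: p) ->
  walk (an G C) (~: C) x (head_at_source m) (last w (unzip2 p))
    (head_at_target (last (m, w) p).1).
Proof.
elim: p x m w => [|[m1 w1] p IH] x m w.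
  by move=> /=; rewrite andbT has_edgeE => e _; apply: walk_edge.
rewrite interior_open_cons => /andP[e1 e2] /andP[ok H].
apply: walk_cat (IH _ _ _ e2 H) ok.
by apply: walk_edge; rewrite -has_edgeE.
Qed.

Lemma walk_list C x s y t : walk (an G C) (~: C) x s y t ->
  exists m w p, [/\ is_walk G x ((m, w) :: p), interior_open G C ((m, w) :: p),
    head_at_source m = s & last w (unzip2 p) = y].
Proof.
suff H : walk (an G C) (~: C) x s y t ->
  exists m p, let q := rcons p (m, y) in [/\ is_walk G x q, interior_open G C q,
   head_at_target m = t & head_at_source (head (m, y) q).1 = s].
  case/H => m [[|[m1 w1] p]] /= [H1 H2 _ H4]; first by exists m, y, [::].
  by exists m1, w1, (rcons p (m, y)); split; rewrite // /unzip2 map_rcons last_rcons.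
elim=> [w r xw|w r s1 v r1 _ [m [p [H1 H2 H3 H4]]] wv ok].
  have [m [H1 H2 H3]] := edge_mark xw.
  by exists m, [::]; split => //=; rewrite H1.
have [m' [H1' H2' H3']] := edge_mark wv.
exists m', (rcons p (m, w)); split=> //.
- by rewrite is_walk_rcons H1 /unzip2 map_rcons last_rcons.
- by rewrite -cats1 interior_open_cat H2 H3 H2' ok.
- by move: H4; case: (p).
Qed.

Lemma is_walk_cat x p q :
  is_walk G x (p ++ q) = is_walk G x p && is_walk G (last x (unzip2 p)) q.
Proof. by elim: p x => [|[m w] p IH] x //=; rewrite IH andbA. Qed.

Lemma split_unzip2 x (p : seq (mark * T)) : x \in unzip2 p ->
  exists p1 m p2, p = p1 ++ (m, x) :: p2.
Proof.
elim: p => [|[m w] p IH] //=; rewrite inE => /predU1P[->|/IH[p1 [m' [p2 ->]]]].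
  by exists [::], m, p.
by exists ((m, w) :: p1), m', p2.
Qed.

(* When a cycle is cut out, the mark at the start of the walk may change; the
   last clause says that this is harmless for a walk arriving at [x]. *)
Lemma list_uniq C x y m w p : is_walk G x ((m, w) :: p) ->
  interior_open G C ((m, w) :: p) -> last w (unzip2 p) = y ->
  x = y \/ exists m' w' q, let r := (m', w') :: q in
    [/\ is_walk G x r, uniq (x :: unzip2 r), last w' (unzip2 q) = y,
     interior_open G C r &
     head_at_source m' = head_at_source m \/
     x \in (if head_at_source m' then an G C else ~: C)].
Proof.
elim: p x m w => [|[m1 w1] p IH] x m w.
  move=> /= e _ <-; have [->|nxw] := eqVneq x w; first by left.
  right; exists m, w, [::]; split => //; last by left.
  by rewrite /= inE nxw.
rewrite interior_open_cons => /andP[e1 e2] /andP[ok o2] /= ey.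
(* Once the rest of the walk has no repetition, [x] recurs in it at most once; everything before
   that recurrence is cut out. *)
suff [r [wr ur er or_]]: exists r, [/\ is_walk G x ((m, w) :: r),
    uniq (w :: unzip2 r), last w (unzip2 r) = y & interior_open G C ((m, w) :: r)].
  have [xr|nxr] := boolP (x \in unzip2 ((m, w) :: r)); last first.
    right; exists m, w, r; split => //; last by left.
    exact/andP.
  have [r1 [m2 [r2 er12]]] := split_unzip2 xr.
  have ur': uniq (unzip2 ((m, w) :: r)) by [].
  have er': last x (unzip2 ((m, w) :: r)) = y by [].
  move: ur' wr or_ er'; rewrite er12 /unzip2 map_cat cat_uniq last_cat /=.
  case/and3P => _ _ ux; case: r2 er12 ux => [|[m3 w3] r3] er12 ux; first by left.
  rewrite is_walk_cat -cat_rcons interior_open_cat.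
  case/and3P => k1 h2 w3' /and3P[o1 okx o3] er'.
  right; exists m3, w3, r3; split => //.
  (* The openness of [x] at its recurrence settles all cases but one: [m3] has an arrowhead at [x],
     and the removed cycle both starts and ends with a tail. There [tails_an] puts [x] in
     [an G C]. *)
  case: (boolP (head_at_source m3)) okx => s3; last by rewrite andbF; right.
  case: (boolP (head_at_target m2)) => t2 okx; first by right.
  case: (boolP (head_at_source m)) => sm; [by left | right].
  case: r1 er12 k1 h2 o1 => [|[m4 w4] r1] /= [em ew _] k1 h2 o1.
    by move: h2; rewrite has_edgeE edge_irr.
  subst m4 w4.
  have := @list_walk C x m w (rcons r1 (m2, x)).
  rewrite last_rcons /unzip2 map_rcons last_rcons (negbTE sm) (negbTE t2).
  move=> H; apply: (tails_an (y := x)); apply: H => //.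
  case/andP: k1 => e3 k1; apply/andP; split => //.
  by have := is_walk_rcons w r1 m2 x; rewrite k1 h2.
case: (IH _ _ _ e2 o2 ey) => [ewy|[m' [w' [q [H1 H2 H3 H4 H5]]]]].
  by exists [::]; split=> //=; rewrite e1.
exists ((m', w') :: q); split => //.
  exact/andP.
rewrite interior_open_cons H4 andbT.
case: H5 => [->//|].
by move: ok; case: (head_at_target m) (head_at_source m') (head_at_source m1) => -[] [].
Qed.

Lemma connP x y C : x != y -> x \notin C -> y \notin C ->
  conn x y C <-> exists p, m_connecting G x y C p.
Proof.
move=> nxy xC yC; split=> [[s [t /walk_list[m [w [p [H1 H2 _ H3]]]]]]|[p]].
  case: (list_uniq H1 H2 H3) => [exy|[m' [w' [q [H4 H5 H6 H7 _]]]]].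
    by rewrite exy eqxx in nxy.
  exists ((m', w') :: q); apply/and4P; split=> //.
  by apply/and3P; split => //; apply/eqP.
case/and4P=> _ _ /and3P[H1 _ /eqP H2] H3.
case: p H1 H2 H3 => [|[m w] p] H1 H2 H3; first by rewrite -H2 eqxx in nxy.
exists (head_at_source m), (head_at_target (last (m, w) p).1).
by move: (list_walk H1 H3); rewrite -H2.
Qed.

(** * Links through colliders, and robustness *)

Definition linked W x y := exists s t, walk (an G W) set0 x s y t.

Definition collider_connected W :=
  forall x y, x \in W -> y \in W -> x != y -> linked W x y.

Definition robust A W := forall x y C,
  x \in W -> y \in W -> x != y -> x \notin C -> y \notin C ->
  W \subset x |: (y |: C) -> C \subset A -> conn x y C.

Lemma linked_conn W x y C : W \subset x |: (y |: C) -> linked W x y -> conn x y C.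
Proof.
move=> sW [s [t xy]]; apply: walk_conn (walk_sub _ _ xy); first exact: anS.
exact: sub0set.
Qed.

Lemma collider_connected_robust A W : collider_connected W -> robust A W.
Proof. by move=> ccW x y C xW yW nxy _ _ sW _; apply/(linked_conn sW)/ccW. Qed.

(** Restart the walk whenever it passes [x] as a noncollider, and stop it when it first passes [y]
    as one. *)
Lemma walk_between P x y s t : walk P [set x; y] x s y t ->
  exists s' t', walk P set0 x s' y t'.
Proof.
move=> xy.
suff H z r : walk P [set x; y] x s z r ->
   (exists s' t', walk P set0 x s' y t') \/ exists s', walk P set0 x s' z r.
  by case: (H _ _ xy) => // -[s' xy']; exists s', t.
elim=> [w r1 xw|w r1 s1 v r2 _ [IH|[s' IH]] wv ok].
- by right; exists s; apply: walk_edge.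
- by left.
case: ifP ok => rs ok.
  by right; exists s'; apply: walk_rcons IH wv _; rewrite rs.
case/set2P: ok => ew; subst w; last by left; exists s', r1.
by right; exists s1; apply: walk_edge.
Qed.

(** Condition on all of [an G W] except [x] and [y]. By [walk_an] the noncolliders can be kept in
    [an G W], so only [x] and [y] can be noncolliders, and [walk_between] removes these. *)
Lemma robustT W : robust setT W -> collider_connected W.
Proof.
move=> rW x y xW yW nxy.
have sWA := subsetP (sub_an W).
have [||||s [t /walk_detour xy]] := rW x y (an G W :\: [set x; y]) xW yW nxy.
- by rewrite !inE eqxx.
- by rewrite !inE eqxx orbT.
- apply/subsetP=> z /sWA zA; rewrite in_setU1 in_setU1 !inE -mem_an zA.
  by case: eqP; case: eqP.
- exact: subsetT.
have {xy} := walk_an (subsetDl _ _) (sWA _ xW) (sWA _ yW) xy.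
move/(walk_sub (P' := an G W) (Q' := [set x; y]) (subsetDl _ _)) => xy.
apply: walk_between (xy _).
apply/subsetP=> z; rewrite in_setI in_setC in_setD => /andP[/nandP[|/negP//]].
by rewrite negbK.
Qed.

(** * Parametrizing sets as collider-connected sets *)

Lemma connect_antisym u v : connect (dir G) u v -> connect (dir G) v u -> u = v.
Proof.
case/connectP=> -[|b p] /=; first by move=> _ ->.
case/andP=> ub bp ev vu; case/negP: (dir_connect_neq ub).
by apply: connect_trans vu; apply/connectP; exists p.
Qed.

Lemma mem_de u v : (v \in de G [set u]) = connect (dir G) u v.
Proof.
rewrite inE; apply/exists_inP/idP => [[w /set1P->] //|uv].
by exists u; rewrite ?set11.
Qed.

Lemma barrenP W h : reflect
  (h \in W /\ forall w, w \in W -> connect (dir G) h w -> w = h) (h \in barren G W).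
Proof.
rewrite inE; apply: (iffP andP) => -[hW H]; split=> //.
  move=> w wW hw; apply/set1P; rewrite -(eqP H) inE wW andbT mem_de //.
apply/eqP/setP=> w; rewrite in_setI mem_de in_set1.
apply/andP/eqP => [[hw wW]|->]; first exact: H.
by rewrite connect0.
Qed.

Lemma barren_sub W : barren G W \subset W.
Proof. by apply/subsetP=> h /barrenP[]. Qed.

(** Among the descendants of [w] in [W], one with the fewest descendants is barren: by acyclicity a
    proper descendant of it would have fewer. *)
Lemma barren_above W w : w \in W ->
  exists2 h, h \in barren G W & connect (dir G) w h.
Proof.
move=> wW; pose c u := (u \in W) && connect (dir G) w u.
have cw: c w by rewrite /c wW connect0.
case: (@arg_minnP _ w c (fun u => #|de G [set u]|) cw) => h /andP[hW wh] hmin.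
exists h => //; apply/barrenP; split=> // u uW hu; apply/eqP.
apply: contraT => nuh; have cu: c u by rewrite /c uW (connect_trans wh hu).
have := hmin u cu; rewrite leqNgt => /negP[]; apply: proper_card.
apply/properP; split.
  by apply/subsetP=> v; rewrite !mem_de; apply: connect_trans.
exists h; rewrite mem_de ?connect0 //.
by apply: contra nuh => uh; apply/eqP/connect_antisym.
Qed.

Lemma an_barren W : an G (barren G W) = an G W.
Proof.
apply/eqP; rewrite eqEsubset anS ?barren_sub // an_sub //.
by apply/subsetP=> w /barren_above[h hH wh]; apply/anP; exists h.
Qed.

Lemma walk_last P x s y t : x \in P -> walk P set0 x s y t ->
  exists u s', u \in P /\ edge u s' y t.
Proof.
move=> xP [w r xw|w r s1 v r1 _ wv]; first by exists x, s.
by case: ifP => _; rewrite ?inE // => wP; exists w, s1.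
Qed.

(** With a tail at [h], the last edge would lead from [h] to an ancestor of some member of [W];
    barrenness makes that member [h] itself, which closes a directed cycle. *)
Lemma barren_head W x s h t : x \in W -> h \in barren G W ->
  walk (an G W) set0 x s h t -> t.
Proof.
move=> xW /barrenP[hW hB] /(walk_last (subsetP (sub_an W) _ xW))[u [s' [uA]]].
case: t s' => [] // -[] // hu.
case/anP: uA => w wW uw; have ewh := hB w wW (connect_trans (connect1 hu) uw).
by subst w; case/negP: (dir_connect_neq hu).
Qed.

(** Since every interior vertex is a collider and the walk ends with an arrowhead, all edges after
    the first are bidirected; the first one is so too unless it leaves [x] with a tail. *)
Lemma walk_district A x s y : x \in A -> y \in A -> walk A set0 x s y true ->
  exists c, [/\ c \in A, if s then c = x else dir G x c
    & connect (bid_in G A) c y].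
Proof.
move=> xA yA xy.
suff H t : walk A set0 x s y t -> y \in A -> t -> exists c,
    [/\ c \in A, if s then c = x else dir G x c & connect (bid_in G A) c y].
  exact: H xy yA isT.
elim=> {y yA xy t} [y t xy|w r s1 v r1 _ IH wv ok] yA et.
  rewrite et in xy; case: s xy => xy; last by exists y.
  by exists x; split=> //; apply: connect1; rewrite /bid_in /= xA yA.
case: ifP ok => [/andP[r_ s1_] wA|]; last by rewrite inE.
rewrite s1_ et in wv; have [c [cA ec cw]] := IH wA r_; exists c; split=> //.
by apply: connect_trans cw _; apply: connect1; rewrite /bid_in /= wA yA.
Qed.

Lemma bid_in_connect_sym A : connect_sym (bid_in G A).
Proof.
by apply: sym_connect_sym => u v; rewrite /bid_in /= bid_sym andbCA.
Qed.

Lemma district_walk A x y : connect (bid_in G A) x y -> x != y ->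
  walk A set0 x true y true.
Proof.
case/connectP=> p; elim: p x => [|b p IH] x /=; first by move=> _ ->; rewrite eqxx.
case/andP=> /and3P[xA bA xb] bp ey nxy.
have xb': walk A set0 x true b true by apply: walk_edge.
have [eby|nby] := eqVneq b y; first by rewrite -eby.
exact: walk_cat xb' (IH b bp ey nby) bA.
Qed.

Lemma dis_inP A B u : reflect
  (u \in A /\ exists2 w, w \in B :&: A & connect (bid_in G A) w u) (u \in dis_in G A B).
Proof.
by rewrite inE; apply: (iffP andP) => -[uA H]; split=> //; apply/exists_inP.
Qed.

(** All of [W] lies in one district [D] of the subgraph on [an G H] or among the parents of [D]. A
    bidirected path in [D], possibly entered from a parent at either end, has only colliders
    inside. *)
Lemma head_tail_linked H W : is_head G H -> H \subset W -> W \subset H :|: tail G H ->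
  collider_connected W.
Proof.
case/andP=> _ /exists_inP[v vA /subsetP Hv] sHW sWH.
pose A := an G H; pose D := dis_in G A H.
have sDA : D \subset A by apply/subsetP=> u /dis_inP[].
have HD : {subset H <= D}.
  move=> h hH; have hA := subsetP (sub_an H) h hH.
  by apply/dis_inP; split=> //; exists h; rewrite ?inE ?hH -?mem_an.
have vD d : d \in D -> connect (bid_in G A) v d.
  case/dis_inP=> _ [h /setIP[/Hv /dis_inP[_ [w /setIP[/set1P-> _] vh]] _] hd].
  exact: connect_trans vh hd.
have DD d e : d \in D -> e \in D -> connect (bid_in G A) d e.
  by move=> /vD vd /vD ve; apply: connect_trans ve; rewrite bid_in_connect_sym.
have WD x : x \in W -> x \in D \/ exists2 d, d \in D & dir G x d.
  move/(subsetP sWH); rewrite in_setU in_setU in_setD => /or3P[/HD||]; first by left.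
  - by case/andP=> _; left.
  - by rewrite inE => /exists_inP[d dD xd]; right; exists d.
have toD x d : x \in W -> d \in D -> x != d -> exists s, walk A set0 x s d true.
  move=> xW dD nxd; case: (WD x xW) => [xD|[e eD xe]].
    by exists true; apply: district_walk nxd; apply: DD.
  exists false; have xe' := walk_dir A set0 xe.
  have [<- //|ned] := eqVneq e d.
  by apply: walk_cat xe' (district_walk (DD _ _ eD dD) ned) _; apply: (subsetP sDA).
move=> x y xW yW nxy.
suff [s [t xy]]: exists s t, walk A set0 x s y t.
  by exists s, t; apply: walk_sub xy => //; apply: anS.
case: (WD y yW) => [yD|[e eD ye]].
  by have [s xy] := toD x y xW yD nxy; exists s, true.
have ey := walk_rev (walk_dir A set0 ye).
have [->|nxe] := eqVneq x e; first by exists true, false.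
have [s xe] := toD x e xW eD nxe; exists s, false.
by apply: walk_cat xe ey _; apply: (subsetP sDA).
Qed.

Lemma param_setsP W :
  reflect (W != set0 /\ collider_connected W) (W \in param_sets G).
Proof.
apply: (iffP imset2P) => [[H A]|[W0 ccW]].
  rewrite inE => Hh; rewrite powersetE => sA ->; split; last first.
    by apply: head_tail_linked Hh (subsetUl _ _) (setUS _ sA).
  case/andP: Hh => _ /exists_inP[v vA _]; case/anP: vA => h hH _.
  by apply/set0Pn; exists h; rewrite inE hH.
(* The head is the barren part of [W]. A link to a barren vertex arrives with an arrowhead, so by
   [walk_district] its other end is in the district of that vertex or is a parent of it, hence in
   the head or the tail. *)
pose H := barren G W; have eA : an G H = an G W := an_barren W.
have sWA := subsetP (sub_an W); have sHW := subsetP (barren_sub W).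
have HA x : x \in H -> x \in an G H by rewrite eA => /sHW/sWA.
have link x h : x \in W -> h \in H -> x != h -> exists c s,
    [/\ c \in an G H, if s then c = x else dir G x c & connect (bid_in G (an G H)) c h].
  move=> xW hH nxh; have [s [t xh]] := ccW x h xW (sHW h hH) nxh.
  have t_ := barren_head xW hH xh; rewrite t_ -eA in xh.
  have xA : x \in an G H by rewrite eA sWA.
  have [c Hc] := walk_district xA (HA h hH) xh.
  by exists c, s.
have hlink x h : x \in H -> h \in H -> connect (bid_in G (an G H)) x h.
  move=> xH hH; have [-> //|nxh] := eqVneq x h.
  have [s [t xh]] := ccW x h (sHW x xH) (sHW h hH) nxh.
  have t_ := barren_head (sHW x xH) hH xh.
  have s_ := barren_head (sHW h hH) xH (walk_rev xh); rewrite t_ s_ -eA in xh.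
  by have [c [_ -> ]] := walk_district (HA x xH) (HA h hH) xh.
have [w wW] := set0Pn _ W0; have [h0 h0H _] := barren_above wW.
exists H (W :\: H).
- rewrite inE; apply/andP; split.
    rewrite eqEsubset barren_sub; apply/subsetP=> h hH; apply/barrenP; split=> //.
    by move=> u /sHW uW hu; case/barrenP: hH => _; apply.
  apply/exists_inP; exists h0; first exact: HA.
  apply/subsetP=> h hH; apply/dis_inP; split; first exact: HA.
  exists h0; last exact: hlink.
  by rewrite in_setI set11 HA.
- rewrite powersetE; apply/subsetP=> x /setDP[xW xH].
  have [h hH xh] := barren_above xW.
  have nxh : x != h by apply: contraNneq xH => ->.
  have [c [s [cA xc ch]]] := link x h xW hH nxh.
  have cD : c \in dis_in G (an G H) H.
    apply/dis_inP; split=> //; exists h; last by rewrite bid_in_connect_sym.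
    by rewrite in_setI hH HA.
  rewrite in_setU in_setD xH; case: s xc => [<-|xc]; first by rewrite cD.
  by apply/orP; right; rewrite inE; apply/exists_inP; exists c.
- by rewrite -{1}(setID W H) (setIidPr (barren_sub W)).
Qed.

Lemma robust_param W : W != set0 -> robust setT W <-> W \in param_sets G.
Proof.
move=> W0; split=> [/robustT ccW|/param_setsP[_]]; first exact/param_setsP.
exact: collider_connected_robust.
Qed.

(** Take for [W] the ends and the colliders of the walk: any two of them are joined by the stretch
    of walk between them. *)
Lemma walk_trace P Q u s v t : walk P Q u s v t -> exists W,
  [/\ u \in W, v \in W, W \subset u |: (v |: P) &
      forall x y, x \in W -> y \in W -> x != y -> exists s' t', walk W Q x s' y t'].
Proof.
(* During the induction the moving end stays out of [W], and enters it only when passed as a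
   collider. *)
move=> uv; suff [W [uW sW toW inW]]: exists W, [/\ u \in W, W \subset u |: P,
    forall x, x \in W -> exists s', walk W Q x s' v t &
    forall x y, x \in W -> y \in W -> x != y -> exists s' t', walk W Q x s' y t'].
  exists (v |: W); rewrite setU11 setU1r //; split=> //.
    by rewrite setUCA setUS.
  have W_v x s' y t' : walk W Q x s' y t' -> walk (v |: W) Q x s' y t'.
    by apply: walk_sub => //; apply: subsetUr.
  move=> x y /setU1P[->|xW] /setU1P[->|yW] nxy; first by rewrite eqxx in nxy.
  - by have [s' /walk_rev] := toW y yW; exists t, s'; apply: W_v.
  - by have [s'] := toW x xW; exists s', t; apply: W_v.
  - by have [s' [t' xy]] := inW x y xW yW nxy; exists s', t'; apply: W_v.
elim: uv => {v t} [v t uv|w r s1 v r1 _ [W [uW sW toW inW]] wv ok].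
  exists [set u]; split; rewrite ?set11 ?subsetUl //.
    by move=> x /set1P->; exists s; apply: walk_edge.
  by move=> x y /set1P-> /set1P->; rewrite eqxx.
case: ifP ok => rs ok; last first.
  exists W; split=> // x xW; have [s' xw] := toW x xW.
  by exists s'; apply: walk_rcons xw wv _; rewrite rs.
have W_w x s' y t' : walk W Q x s' y t' -> walk (w |: W) Q x s' y t'.
  by apply: walk_sub => //; apply: subsetUr.
exists (w |: W); split.
- by rewrite setU1r.
- by rewrite subUset sub1set setU1r.
- move=> x /setU1P[->|xW]; first by exists s1; apply: walk_edge.
  have [s' /W_w xw] := toW x xW; exists s'.
  by apply: walk_rcons xw wv _; rewrite rs setU11.
move=> x y /setU1P[->|xW] /setU1P[->|yW] nxy; first by rewrite eqxx in nxy.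
- by have [s' /walk_rev] := toW y yW; exists r, s'; apply: W_w.
- by have [s'] := toW x xW; exists s', r; apply: W_w.
- by have [s' [t' xy]] := inW x y xW yW nxy; exists s', t'; apply: W_w.
Qed.

(** For the set [W] of [walk_trace], a set [C] inside [A] misses the noncolliders, and together with
    [x] and [y] it covers the colliders. *)
Lemma walk_robust A P u s v t : walk P (~: A) u s v t ->
  exists W, [/\ u \in W, v \in W, W \subset u |: (v |: P) & robust A W].
Proof.
case/walk_trace=> W [uW vW sW H]; exists W; split=> //.
move=> x y C xW yW nxy _ _ sWC sCA; have [s' [t' xy]] := H x y xW yW nxy.
apply: walk_conn (walk_sub _ _ xy).
  by apply: subset_trans sWC (sub_an _).
by rewrite setCS.
Qed.

End Walks.

(** * Equality of the parametrizing sets transfers connection *)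

Section Transfer.
Variable T : finType.
Implicit Types (G : admg T) (A B C W : {set T}) (x y z : T).

Lemma linkedS G W W' x y : W \subset W' -> linked G W x y -> linked G W' x y.
Proof. by move=> sW [s [t xy]]; exists s, t; apply: walk_sub xy => //; apply: anS. Qed.

Lemma linked_sym G W x y : linked G W x y -> linked G W y x.
Proof. by case=> s [t /walk_rev]; exists t, s. Qed.

(* As [z] has no child in [A], any two walks that meet at [z] inside [A] form a
   collider there. *)
Lemma param_setsU G A z W1 W2 : an G A \subset A ->
  (forall c, c \in A -> ~~ dir G z c) -> W1 \subset A -> W2 \subset A ->
  z \in W1 -> z \in W2 -> W1 \in param_sets G -> W2 \in param_sets G ->
  W1 :|: W2 \in param_sets G.
Proof.
move=> sAA zsink sW1 sW2 zW1 zW2 /param_setsP[_ cc1] /param_setsP[_ cc2].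
have into_z W x s t : W \subset A -> x \in W -> walk G (an G W) set0 x s z t -> t.
  move=> sW xW /(walk_last (subsetP (sub_an G W) _ xW))[u [s' [uW]]].
  have uA : u \in A by apply/(subsetP sAA)/(subsetP (anS G sW)).
  by case: t s' => [] // -[] //=; rewrite (negbTE (zsink u uA)).
have cross x y : x \in W1 -> y \in W2 -> x != y -> linked G (W1 :|: W2) x y.
  move=> xW1 yW2 nxy.
  have [exz|nxz] := eqVneq x z.
    by apply: (linkedS (subsetUr _ _)); apply: cc2; rewrite // exz.
  have [eyz|nyz] := eqVneq y z.
    by apply: (linkedS (subsetUl _ _)); apply: cc1; rewrite // eyz.
  have [s [t xz]] := cc1 x z xW1 zW1 nxz.
  have [s' [t' yz]] := cc2 y z yW2 zW2 nyz.
  have t_ := into_z _ _ _ _ sW1 xW1 xz; have t'_ := into_z _ _ _ _ sW2 yW2 yz.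
  exists s, s'.
  have xz' : walk G (an G (W1 :|: W2)) set0 x s z t.
    by apply: walk_sub xz => //; apply/anS/subsetUl.
  have zy' : walk G (an G (W1 :|: W2)) set0 z t' y s'.
    by apply/walk_rev; apply: walk_sub yz => //; apply/anS/subsetUr.
  apply: walk_cat xz' zy' _; rewrite t_ t'_.
  by apply: (subsetP (sub_an _ _)); rewrite inE zW1.
apply/param_setsP; split; first by apply/set0Pn; exists z; rewrite inE zW1.
move=> x y /setUP[xW|xW] /setUP[yW|yW] nxy.
- by apply: linkedS (cc1 x y xW yW nxy); apply: subsetUl.
- exact: cross.
- by apply/linked_sym/cross; rewrite // eq_sym.
- by apply: linkedS (cc2 x y xW yW nxy); apply: subsetUr.
Qed.

(* A walk from [x] is followed while remembering the last vertex [u] of [A]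
   outside [C] that is reachable without passing through [z] as a noncollider.
   A passage [u .. z .. v] with [z] as a noncollider is replaced, via the union
   property, by a walk from [u] to [v] whose interior vertices are colliders. *)
Lemma robustU1 G A z W : z \notin A -> W \subset A ->
  (forall W', W' != set0 -> W' \subset z |: A -> robust G (z |: A) W' ->
     W' \in param_sets G) ->
  (forall W1 W2, W1 \in param_sets G -> W2 \in param_sets G ->
     W1 \subset z |: A -> W2 \subset z |: A -> z \in W1 -> z \in W2 ->
     W1 :|: W2 \in param_sets G) ->
  robust G A W -> robust G (z |: A) W.
Proof.
set A' := z |: A => zA sWA paramA' paramU robW x y C xW yW nxy xC yC sWC sCA'.
have [zC|zC] := boolP (z \in C); last first.
  apply: robW => //; apply/subsetP=> c cC.
  by case/setU1P: (subsetP sCA' c cC) zC => // <-; rewrite cC.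
have sCzC : C :\ z \subset C := subsetDl _ _.
set B := x |: (y |: C).
(* Robustness in [A] applies only after [z] is taken out of [C]; the resulting walk may therefore
   have [z] as a noncollider. *)
have [||||s [t /walk_detour xy]] := robW x y (C :\ z) xW yW nxy.
- by apply: contra xC; apply: subsetP.
- by apply: contra yC; apply: subsetP.
- apply/subsetP=> w wW; have := subsetP sWC w wW; rewrite !in_setU1 in_setD1.
  by have -> : w != z by apply: contraNneq zA => <-; apply: (subsetP sWA).
- apply/subsetP=> c /setD1P[ncz /(subsetP sCA')/setU1P[ecz|//]].
  by rewrite ecz eqxx in ncz.
have sCB : C \subset an G B.
  by apply: subset_trans (sub_an _ _); apply/subsetP=> c cC; rewrite !inE cC !orbT.
have xB : x \in an G B by apply: (subsetP (sub_an _ _)); rewrite !inE eqxx.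
have yB : y \in an G B by apply: (subsetP (sub_an _ _)); rewrite !inE eqxx orbT.
have {}xy := walk_an (subset_trans sCzC sCB) xB yB xy.
have inA' v : v \in A -> v \in A' by move=> vA; rewrite inE vA orbT.
pose g u := u = x \/ exists s t, walk G (an G B) (~: C) x s u t.
pose p u := [/\ u \in A, u \notin C, u \in an G B & g u].
pose inner := walk G (C :\ z) (~: A').
have g_cat u s1 v t1 : p u -> walk G (an G B) (~: C) u s1 v t1 -> g v.
  case=> uA uC uB [-> uv|[s2 [t2 xu]] uv]; first by right; exists s1, t1.
  by right; exists s2, t1; apply: walk_cat xu uv _; case: ifP; rewrite // inE.
have subA' u v : u \in A' -> v \in A' -> u |: (v |: C :\ z) \subset A'.
  by move=> uA vA; rewrite !subUset !sub1set uA vA (subset_trans sCzC).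
have inner_param u s1 v t1 : inner u s1 v t1 -> u \in A' -> v \in A' ->
    exists W', [/\ W' \in param_sets G, u \in W', v \in W'
      & W' \subset u |: (v |: C :\ z)].
  move=> uv uA' vA'; have [W' [uW vW sW' rW']] := walk_robust uv; exists W'; split=> //.
  apply: paramA' => //; first by apply/set0Pn; exists u.
  exact: subset_trans sW' (subA' _ _ uA' vA').
have zA' : z \in A' := setU11 _ _.
(* The set [W1] records that [z] has been passed as a noncollider since the cut point [u]; the first
   alternative of [state] is that this has not happened. *)
pose q u W1 := [/\ W1 \in param_sets G, u \in W1, z \in W1 & W1 \subset u |: C].
pose state v t :=
  (exists u s', p u /\ inner u s' v t) \/
  (exists u W1 s', [/\ p u, q u W1 & inner z s' v t]).
have finish v t1 : v \in A -> v \notin C -> v \in an G B -> state v t1 -> g v.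
  move=> vA vC vB [[u [s1 [pu uv]]]|[u [W1 [s1 [pu [W1S uW1 zW1 sW1] zv]]]]].
    apply: g_cat pu (walk_sub _ _ uv); first exact: subset_trans sCzC sCB.
    by rewrite setCS.
  (* The pieces [u .. z] and [z .. v] give members [W1] and [W2] of the family that share [z]; their
     union links [u] to [v]. *)
  have [W2 [W2S zW2 vW2 sW2]] := inner_param _ _ _ _ zv zA' (inA' _ vA).
  have [uA uC uB gu] := pu; have [<- //|nuv] := eqVneq u v.
  have sW1A : W1 \subset A'.
    by apply: subset_trans sW1 _; rewrite subUset sub1set inA'.
  have sW2A : W2 \subset A' by apply: subset_trans sW2 (subA' _ _ zA' (inA' _ vA)).
  have /param_setsP[_ cc] := paramU W1 W2 W1S W2S sW1A sW2A zW1 zW2.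
  have [||s2 [t2 uv]] := cc u v _ _ nuv; rewrite ?inE ?uW1 ?vW2 ?orbT //.
  apply: g_cat pu (walk_sub _ _ uv); last exact: sub0set.
  apply: an_sub; rewrite subUset (subset_trans sW1) ?(subset_trans sW2) //.
    by rewrite !subUset !sub1set (subsetP sCB z zC) vB (subset_trans sCzC).
  by rewrite subUset sub1set uB.
have p_x : p x by split=> //; [apply: (subsetP sWA) | left].
have step v t1 : walk G (C :\ z) (~: (C :\ z) :&: an G B) x s v t1 -> state v t1.
  elim=> [w r xw|w r s1 v' r1 _ IH wv ok].
    by left; exists x, s; split=> //; apply: walk_edge.
  have ext a s2 : inner a s2 w r -> w \in (if r && s1 then C :\ z else ~: A') ->
      inner a s2 v' r1 by move=> aw; apply: walk_rcons aw wv.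
  have keep : w \in (if r && s1 then C :\ z else ~: A') -> state v' r1.
    move=> ok'; case: IH => [[u [s2 [pu uw]]]|[u [W1 [s2 [pu qW1 zw]]]]].
      by left; exists u, s2; split=> //; apply: ext.
    by right; exists u, W1, s2; split=> //; apply: ext.
  case: ifP ok => rs ok; first by apply: keep; rewrite rs.
  have [wA'|wA'] := boolP (w \in A'); last by apply: keep; rewrite rs inE.
  case/setIP: ok; rewrite inE in_setD1 => wCz wB.
  have [ewz|nwz] := eqVneq w z.
    subst w; right; case: IH => [[u [s2 [pu uz]]]|[u [W1 [s2 [pu qW1 _]]]]].
      have [uA uC uB gu] := pu.
      have [W1 [W1S uW1 zW1 sW1]] := inner_param _ _ _ _ uz (inA' _ uA) zA'.
      exists u, W1, s1; split=> //; last exact: walk_edge.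
      by split=> //; rewrite setD1K in sW1.
    (* On another passage through [z], the loop from [z] to [z] is dropped and [W1] is kept. *)
    by exists u, W1, s1; split=> //; apply: walk_edge.
  have wC : w \notin C by rewrite nwz in wCz.
  have wA : w \in A by case/setU1P: wA' => // ewz; rewrite ewz eqxx in nwz.
  left; exists w, s1; split; last exact: walk_edge.
  by split=> //; apply: finish IH.
have yA := subsetP sWA y yW.
case: (finish y t yA yC yB (step _ _ xy)) => [eyx|[s1 [t1]]]; last exact: walk_conn.
by rewrite eyx eqxx in nxy.
Qed.

(** Choose [z] outside [A] with the fewest ancestors: any other ancestor of [z] outside [A] would
    have fewer. *)
Lemma ancestral_next G A : an G A \subset A -> A != setT ->
  exists2 z, z \notin A & an G (z |: A) \subset z |: A.
Proof.
move=> sAA nA; have /existsP[w wA] : [exists w, w \notin A].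
  rewrite -negb_forall; apply: contra nA => /forallP H.
  by apply/eqP/setP=> w; rewrite H inE.
case: (@arg_minnP _ w [pred w | w \notin A] (fun u => #|an G [set u]|) wA) => z /= zA zmin.
exists z => //; apply/subsetP=> u /anP[v /setU1P[->|vA] uv]; last first.
  by rewrite inE (subsetP sAA) ?orbT //; apply/anP; exists v.
rewrite in_setU1; apply/norP=> -[nuz uA].
have := zmin u uA; rewrite leqNgt => /negP[]; apply/proper_card/properP; split.
  by apply: an_sub; rewrite sub1set; apply/anP; exists z; rewrite ?set11.
exists z; first by apply/anP; exists z; rewrite ?set11.
apply: contra nuz => /anP[u' /set1P-> zu]; apply/eqP/(connect_antisym uv zu).
Qed.

(** Induction on the number of vertices outside [A]; for [A = setT] robustness is membership in the
    family of [G2]. In the step, [robustU1] works in [G2], but its union hypothesis comes from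
    [param_setsU] in [G1]: [z] has no child in [z |: A] because [A] is ancestral in [G1]. *)
Lemma robust_param_ancestral G1 G2 A W : param_sets G1 = param_sets G2 ->
  an G1 A \subset A -> W != set0 -> W \subset A -> robust G2 A W ->
  W \in param_sets G1.
Proof.
move=> eS; move: {2}#|~: A| (leqnn #|~: A|) => n.
elim: n A W => [|n IH] A W leA sAA W0 sWA robW.
  have AT : A = setT.
    by apply/eqP; rewrite leqn0 cards_eq0 -setCT (can_eq (@setCK _)) in leA.
  by rewrite eS; apply/robust_param; rewrite // -AT.
have [AT|nA] := eqVneq A setT.
  by rewrite eS; apply/robust_param; rewrite // -AT.
have [z zA sAA'] := ancestral_next sAA nA.
have leA' : #|~: (z |: A)| <= n.
  rewrite -ltnS; apply: leq_trans leA; apply/proper_card/properP; split.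
    by rewrite setCS subsetUr.
  by exists z; rewrite !inE ?zA ?eqxx.
apply: (IH (z |: A)) => //; first by apply: subset_trans sWA (subsetUr _ _).
apply: robustU1 => // [W' W'0 sW' robW'|W1 W2]; rewrite -eS; first exact: IH robW'.
move=> W1S W2S sW1 sW2 zW1 zW2.
apply: (param_setsU sAA' _ sW1 sW2 zW1 zW2 W1S W2S) => c /setU1P[->|cA].
  by rewrite dir_irr.
apply: contra zA => zc; apply: (subsetP sAA).
exact: dir_an zc (subsetP (sub_an _ _) c cA).
Qed.

Lemma conn_transfer G1 G2 x y C : param_sets G1 = param_sets G2 ->
  x != y -> x \notin C -> y \notin C -> conn G2 x y C -> conn G1 x y C.
Proof.
move=> eS nxy xC yC [s [t /walk_detour xy]].
set B := x |: (y |: C); pose A := an G1 B.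
have sBA : B \subset A := sub_an _ _.
have sAA : an G1 A \subset A by apply: an_sub.
have xA : x \in A by apply: (subsetP sBA); rewrite !inE eqxx.
have yA : y \in A by apply: (subsetP sBA); rewrite !inE eqxx orbT.
have sCA : C \subset A.
  by apply: subset_trans sBA; apply/subsetP=> c cC; rewrite !inE cC !orbT.
pose g u := u = x \/ exists s t, walk G1 A (~: C) x s u t.
(* [u] is the last cut point, already reached in [G1]; the [G2]-walk from [u] to [v] is the current
   piece, without noncolliders in [A]. *)
pose state v t := exists u s', [/\ u \in A, u \notin C, g u & walk G2 C (~: A) u s' v t].
have finish v t1 : v \in A -> state v t1 -> g v.
  move=> vA [u [s1 [uA uC gu uv]]]; have [<- //|nuv] := eqVneq u v.
  have [W [uW vW sW robW]] := walk_robust uv.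
  have sWA : W \subset A by apply: subset_trans sW _; rewrite !subUset !sub1set uA vA.
  have W0 : W != set0 by apply/set0Pn; exists u.
  have /param_setsP[_ cc] := robust_param_ancestral eS sAA W0 sWA robW.
  have [s2 [t2 /(walk_sub (an_sub sWA) (sub0set (~: C))) uv']] := cc u v uW vW nuv.
  case: gu => [eux|[s3 [t3 xu]]]; first by right; exists s2, t2; rewrite -eux.
  (* A cut point is in [A] and outside [C], so it may be a collider or a noncollider of the
     concatenation. *)
  right; exists s3, t2; apply: walk_cat xu uv' _.
  by case: ifP; rewrite // inE.
have step v t1 : walk G2 C (~: C) x s v t1 -> state v t1.
  elim=> [w r xw|w r s1 v' r1 _ IH wv ok].
    by exists x, s; split=> //; [left | apply: walk_edge].
  have keep : w \in (if r && s1 then C else ~: A) -> state v' r1.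
    case: IH => u [s2 [uA uC gu uw]] ok'; exists u, s2; split=> //.
    exact: walk_rcons uw wv ok'.
  case: ifP ok => rs ok; first by apply: keep; rewrite rs.
  have [wA|wA] := boolP (w \in A); last by apply: keep; rewrite rs inE.
  exists w, s1; split=> //; last exact: walk_edge.
    by rewrite inE in ok.
  exact: finish IH.
case: (finish y t yA (step _ _ xy)) => [eyx|[s1 [t1]]]; last exact: walk_conn.
by rewrite eyx eqxx in nxy.
Qed.

(** * Separation and Markov equivalence in terms of [conn] *)

Lemma m_separatedP G A B C : [disjoint A & B] -> [disjoint A & C] -> [disjoint B & C] ->
  m_separated G A B C <-> forall a b, a \in A -> b \in B -> ~ conn G a b C.
Proof.
move=> dAB dAC dBC.
have H a b : a \in A -> b \in B -> conn G a b C <-> exists p, m_connecting G a b C p.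
  move=> aA bB; apply: connP.
  - by apply: contraTneq bB => <-; rewrite (disjointFr dAB).
  - by rewrite (disjointFr dAC).
  - by rewrite (disjointFr dBC).
split=> [sepG a b aA bB /(H a b aA bB)[p]|nc a b p aA bB]; first exact/negP/sepG.
by apply/negP=> abp; case: (nc a b aA bB); apply/(H a b aA bB); exists p.
Qed.

Lemma markov_conn G1 G2 x y C : markov_equivalent G1 G2 ->
  x != y -> x \notin C -> y \notin C -> conn G1 x y C -> conn G2 x y C.
Proof.
(* Separation is the negation of connection, so the equivalence alone yields only a double
   negation. *)
move=> eM nxy xC yC c1; apply: NNPP => nc2.
have dxy : [disjoint [set x] & [set y]] by rewrite disjoints1 inE.
have dxC : [disjoint [set x] & C] by rewrite disjoints1.
have dyC : [disjoint [set y] & C] by rewrite disjoints1.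
have ne (v : T) : [set v] != set0 by apply/set0Pn; exists v; rewrite set11.
have [_] := eM _ _ C (ne x) (ne y) dxy dxC dyC.
rewrite !m_separatedP // => H; apply: H c1; rewrite ?set11 //.
by move=> a b /set1P-> /set1P->.
Qed.

Lemma markov_param_sets G1 G2 : markov_equivalent G1 G2 ->
  param_sets G1 \subset param_sets G2.
Proof.
move=> eM; apply/subsetP=> W WS; have [W0 _] := param_setsP _ _ WS.
apply/robust_param=> // x y C xW yW nxy xC yC sW sC.
apply: (markov_conn eM) => //; have/robust_param rW := WS; exact: (rW W0 x y C).
Qed.

End Transfer.

Theorem theorem3p8 (T : finType) (G1 G2 : admg T) :
  markov_equivalent G1 G2 <-> param_sets G1 = param_sets G2.
Proof.
split=> [eM|eS].
  apply/eqP; rewrite eqEsubset !markov_param_sets //.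
  by move=> A B C A0 B0 dAB dAC dBC; apply: iff_sym; apply: eM.
move=> A B C _ _ dAB dAC dBC; rewrite !m_separatedP //.
have nab a b : a \in A -> b \in B -> a != b.
  by move=> aA; apply: contraTneq => <-; rewrite (disjointFr dAB).
have nC a : a \in A -> a \notin C by move=> aA; rewrite (disjointFr dAC).
have nC' b : b \in B -> b \notin C by move=> bB; rewrite (disjointFr dBC).
split=> nc a b aA bB c; apply: (nc a b aA bB).
  exact: conn_transfer eS (nab a b aA bB) (nC a aA) (nC' b bB) c.
exact: conn_transfer (esym eS) (nab a b aA bB) (nC a aA) (nC' b bB) c.
Qed.
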